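(* Let $n\ge 3$. (i) For every tower $(g_2,\dots,g_n)$, the word $M_n g_n$ traverses a genlex Hamiltonian cycle in $\mathrm{Cay}(S_n,\{g_2,\dots,g_n\})$: the walk reading $M_n g_n$ from any starting vertex returns to that vertex, visits every element of $S_n$ exactly once before returning, and the resulting cyclic listing of $S_n$ is genlex. (ii) Conversely, let $\pi_0,\pi_1,\dots,\pi_{n!-1}$ be a genlex Hamiltonian listing of $S_n$ (not assumed to close into a cycle) which uses $n-1$ generators, i.e. the set $\{\pi_i^{-1}\pi_{i+1} : 0\le i<n!-1\}$ has exactly $n-1$ elements. Then there is a unique tower $(g_2,\dots,g_n)$ such that the listing is the walk reading the word $M_n$ from $\pi_0$. In this tower, $g_k$ is the generator of the listing lying in the layer $G_k\setminus G_{k-1}$, and the quotients $g_{k-1}^{-1}g_k$ (with $g_1=\mathbf 1$) are necessarily $k$-cycles on $\{1,\dots,k\}$, for $2\le k\le n$. Zaks' order is the case $g_k=r_k$ $(2\le k\le n)$, where $r_k$ is the reversal of the first $k$ letters; in particular $(r_2,\dots,r_n)$ is a tower.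
   Context: $S_n$ is the group of permutations of $\{1,\dots,n\}$, with one-line notation $\pi=\pi_1\cdots\pi_n$. Operations act on positions, on the right: $(\pi g)_i=\pi_{g(i)}$, i.e. $\pi g$ is the composition $i\mapsto \pi(g(i))$. For $1\le k\le n$, $G_k=\mathrm{Sym}\{1,\dots,k\}$ is the subgroup of permutations fixing each of $k+1,\dots,n$; so $G_1=\{\mathbf 1\}$ and $G_n=S_n$. The sets $G_k\setminus G_{k-1}$, $2\le k\le n$, are called layers. A $k$-cycle on $\{1,\dots,k\}$ is an element of $G_k$ that is a single cycle of length $k$. A tower is a sequence $(g_2,\dots,g_n)$ with $g_k\in G_k\setminus G_{k-1}$ such that, setting $g_1:=\mathbf 1$, each $u_k:=g_{k-1}^{-1}g_k$ is a $k$-cycle on $\{1,\dots,k\}$ $(2\le k\le n)$. Words over the alphabet $\{g_2,\dots,g_n\}$: $M_1=\varepsilon$ (empty word) and $M_k=(M_{k-1}\,g_k)^{k-1}M_{k-1}$ for $2\le k\le n$; so $|M_k|=k!-1$. A word $w_1w_2\cdots w_N$ is read from a vertex $\pi$ as the walk $\pi,\ \pi w_1,\ \pi w_1w_2,\ \dots,\ \pi w_1\cdots w_N$ in the Cayley graph (edges are right multiplications by generators). A Hamiltonian listing of $S_n$ is a sequence $\pi_0,\dots,\pi_{n!-1}$ containing each element of $S_n$ exactly once; its generators are the elements $\pi_i^{-1}\pi_{i+1}$. A listing is genlex when, for every $k$, the permutations agreeing in their last $n-k$ letters are consecutive, equivalently each left coset $\pi G_k$ occupies consecutive positions; for a cyclic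 listing, ''consecutive'' means ''occupying a contiguous arc''. $r_k\in S_n$ is given by $r_k(i)=k+1-i$ for $i\le k$ and $r_k(i)=i$ for $i>k$. Zaks' order is the listing of $S_n$ produced by the recursion above with the prefix reversals $r_2,\dots,r_n$ as letters. *)

(* Defs.v *)
From mathcomp Require Import all_boot all_fingroup.

Set Implicit Arguments.
Unset Strict Implicit.
Unset Printing Implicit Defensive.

(* Positions and letters 1, ..., n are represented by 0, ..., n - 1 in 'I_n;
   all indices k (of layers, generators, words) are kept 1-based. *)

(* The product of {perm T} is diagrammatic, (s * t) i = t (s i), so the
   right action on positions, (rmul p g) i = p (g i), swaps the factors. *)
Definition rmul n (p g : 'S_n) : 'S_n := (g * p)%g.

Lemma rmulE n (p g : 'S_n) i : rmul p g i = p (g i).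
Proof. by rewrite permM. Qed.

(* p^-1 q for the composition rmul. *)
Definition quo n (p q : 'S_n) : 'S_n := rmul p^-1%g q.

Definition first n k : {set 'I_n} := [set i : 'I_n | i < k].

Definition G n k : {set 'S_n} := Sym (first n k).

Definition layer n k : {set 'S_n} := G n k :\: G n k.-1.

Definition is_kcycle n k (u : 'S_n) : bool :=
  (u \in G n k) && (first n k \in porbits u).

(* A sequence (g_2, ..., g_n) is a tuple of length n - 1 with g_k at index
   k - 2; letter g k is g_k, with the convention g_1 = 1. *)
Definition letter n (g : n.-1.-tuple 'S_n) (k : nat) : 'S_n :=
  if k is j.+2 then nth 1%g g j else 1%g.

Definition is_tower n (g : n.-1.-tuple 'S_n) : Prop :=
  forall k, 2 <= k <= n ->
    letter g k \in layer n k /\ is_kcycle k (quo (letter g k.-1) (letter g k)).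

(* M_1 is empty and M_k = (M_(k-1) g_k)^(k-1) M_(k-1). *)
Fixpoint Mword n (a : nat -> 'S_n) (k : nat) : seq 'S_n :=
  if k is k'.+1 then
    flatten (nseq k' (rcons (Mword a k') (a k))) ++ Mword a k'
  else [::].

Definition walk n (p : 'S_n) (w : seq 'S_n) : seq 'S_n := p :: scanl (@rmul n) p w.

Definition cayley n (A : seq 'S_n) : rel 'S_n :=
  fun p q => has (fun s => q == rmul p s) A.

Definition is_listing n (L : seq 'S_n) : Prop := forall s, count_mem s L = 1.

Definition generators n (L : seq 'S_n) : {set 'S_n} :=
  [set quo (nth 1%g L i) (nth 1%g L i.+1) | i : 'I_(size L).-1].

(* p and q agree in their last n - k letters. *)
Definition agree n k (p q : 'S_n) : bool :=
  [forall i : 'I_n, (k <= i) ==> (p i == q i)].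

(* The entries of L satisfying P are consecutive: together they form a
   contiguous factor of L. *)
Definition consecutive (T : eqType) (P : pred T) (L : seq T) : bool :=
  infix (filter P L) L.

Definition genlex n (L : seq 'S_n) : Prop :=
  forall k, 1 <= k <= n -> forall p, consecutive (agree k p) L.

(* A contiguous arc of the cyclic sequence L is a factor of a rotation of L. *)
Definition genlex_cyclic n (L : seq 'S_n) : Prop :=
  forall k, 1 <= k <= n -> forall p,
    exists r, consecutive (agree k p) (rot r L).

(* The reversal i |-> k + 1 - i reads i |-> k - 1 - i on 0-based positions.
   The default value of insubd is reached only when k > n. *)
Definition rev_fun n k (i : 'I_n) : 'I_n :=
  if i < k then insubd i (k - i.+1) else i.

Lemma rev_funK n k : involutive (@rev_fun n k).
Proof.
move=> i; rewrite /rev_fun; case: (ltnP i k) => [lt_ik|]; last first.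
  by move=> le_ki; rewrite ltnNge le_ki.
apply: val_inj; case: (ltnP (k - i.+1) n) => [lt_n|le_n].
  have vE : val (insubd i (k - i.+1)) = k - i.+1 by rewrite val_insubd lt_n.
  rewrite vE; have -> : k - i.+1 < k by rewrite ltn_subrL (leq_ltn_trans _ lt_ik).
  have kE : k - (k - i.+1).+1 = i by rewrite subnSK // subKn // ltnW.
  by rewrite val_insubd kE ltn_ord.
have iE : insubd i (k - i.+1) = i.
  by apply: val_inj; rewrite val_insubd ltnNge le_n.
by rewrite iE lt_ik iE.
Qed.

Definition reversal n k : 'S_n := perm (inv_inj (@rev_funK n k)).

Definition zaks_gens n : n.-1.-tuple 'S_n := [tuple reversal n i.+2 | i < n.-1].

Definition zaks_order n (p : 'S_n) : seq 'S_n := walk p (Mword (reversal n) n).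

(* Main.v *)
Require Import Defs.
From mathcomp Require Import all_boot all_fingroup.

Set Implicit Arguments.
Unset Strict Implicit.
Unset Printing Implicit Defensive.

(** The word [Mword a k.+1] repeats [Mword a k] with the letter [a k.+1] in
   between, so its walk from [p] consists of [k.+1] translates of the walk of
   [Mword a k], starting at the points [p u^j], [j <= k], where [u] is the
   value of [Mword a k] followed by [a k.+1] (products are those of [rmul]).  It covers the coset of
   [G n k.+1] once exactly when these starting points lie in distinct cosets
   of [G n k].  Cosets of [G n k] inside a coset of [G n k.+1] are told apart by
   the image of the position [k] (counting from 0), so this means that the
   images of [k] under [1, u, ..., u^k] are distinct, that is, that [u] is a
   cycle on the first [k.+1] positions ([kcycle_uniq]).

   For a tower, [Mword a k] has value [(a k)^-1] ([eval_Mword_tower]).  Indeed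
   if this holds for [k] then [u] is the quotient of [a k] and [a k.+1], and
   [u^k (a k)^-1 = u^(k+1) (a k.+1)^-1 = (a k.+1)^-1].  This makes the tower
   condition the one required above, and it also says that the last letter
   [a n] closes the walk.  All the blocks met on the way are cosets, hence the
   genlex property.

   Conversely, in a genlex listing the cosets of [G n k] are intervals of
   length [k!] that tile the positions from 0 on ([consecutive_classes]).  So
   the transition into position [i] lies in the layer [k] if and only if
   [(k - 1)!] divides [i] and [k!] does not.  Each of the [n - 1] layers is
   met, and with [n - 1] generators each of them contains exactly one
   ([generators_layer]).  The letters of [Mword a n] obey the same divisibility
   rule ([nth_Mword]), so the listing is the walk of this word.  Finally the
   starting points of the blocks lie in distinct cosets, and the first
   equivalence above, read backwards, gives the cycles ([listing_kcycle]).

   The quotient of consecutive prefix reversals is a rotation of the prefix,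
   so the reversals form a tower. *)

(** * Agreement classes and cosets of prefix groups *)

Section Cosets.

Variable n : nat.
Implicit Types (p q u : 'S_n) (k : nat).

Lemma agreeP k p q :
  reflect (forall i : 'I_n, k <= i -> p i = q i) (agree k p q).
Proof.
apply: (iffP forallP) => [pq i ki|pq i]; first exact/eqP/(implyP (pq i)).
by apply/implyP => /pq ->.
Qed.

Lemma agree_refl k p : agree k p p.
Proof. exact/agreeP. Qed.

Lemma agree_sym k p q : agree k p q = agree k q p.
Proof. by apply/agreeP/agreeP => pq i /pq. Qed.

Lemma agree_trans k : transitive (@agree n k).
Proof.
by move=> q p r /agreeP pq /agreeP qr; apply/agreeP => i ki; rewrite pq ?qr.
Qed.

Lemma agree_eql k p q : agree k p q -> agree k p =1 agree k q.
Proof.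
by move=> pq r; apply/idP/idP; apply: agree_trans; rewrite // agree_sym.
Qed.

Lemma agree_le j k p q : j <= k -> agree j p q -> agree k p q.
Proof.
by move=> jk /agreeP pq; apply/agreeP => i ki; apply/pq/(leq_trans jk).
Qed.

Lemma agree_full p q : agree n p q.
Proof. by apply/agreeP => i; rewrite leqNgt ltn_ord. Qed.

Lemma agree0 p q : agree 0 p q = (p == q).
Proof.
apply/idP/eqP => [/agreeP pq|->]; last exact: agree_refl.
by apply/permP => i; apply: pq.
Qed.

Lemma quoE p q i : quo p q i = (p^-1)%g (q i).
Proof. exact: rmulE. Qed.

Lemma rmul_quo p q : rmul p (quo p q) = q.
Proof. by rewrite /quo /rmul mulgKV. Qed.

Lemma quo_rmul p q : quo p (rmul p q) = q.
Proof. by rewrite /quo /rmul mulgK. Qed.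

Lemma mem_G k u : (u \in G n k) = agree k 1%g u.
Proof.
rewrite /G /Sym inE; apply/subsetP/agreeP => [fix_u i ki|fix_u i].
  by rewrite perm1; apply/eqP; apply: contraTT ki => u_i; rewrite -ltnNge;
     have:= fix_u i; rewrite !inE eq_sym => ->.
by rewrite !inE; apply: contraR; rewrite -leqNgt => /fix_u; rewrite perm1 => <-.
Qed.

Lemma agree_quo k p q : agree k p q = (quo p q \in G n k).
Proof.
rewrite mem_G; apply/agreeP/agreeP => pq i /pq; rewrite quoE perm1.
  by move=> <-; rewrite permK.
by move=> /(canLR (permK _)); rewrite invgK.
Qed.

Lemma agree_rmul k p u : agree k p (rmul p u) = (u \in G n k).
Proof. by rewrite agree_quo quo_rmul. Qed.

Lemma mem_layer k p q :
  (quo p q \in layer n k) = agree k p q && ~~ agree k.-1 p q.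
Proof. by rewrite !agree_quo in_setD andbC. Qed.

Lemma layer_inj j k u : u \in layer n j -> u \in layer n k -> j = k.
Proof.
wlog jk : j k / j <= k => [IH uj uk|].
  by case/orP: (leq_total j k) => /IH; [apply | move=> /(_ uk uj)].
rewrite !in_setD !mem_G => /andP[_ uj] /andP[nuk _].
apply/eqP; rewrite eqn_leq jk leqNgt; apply: contra nuk => lt_jk.
by apply: agree_le uj; rewrite -ltnS (ltn_predK lt_jk).
Qed.

Lemma expg_G k u j : u \in G n k -> (u ^+ j)%g \in G n k.
Proof. exact: groupX. Qed.

Lemma G_lt k u (i : 'I_n) : u \in G n k -> i < k -> u i < k.
Proof.
rewrite mem_G => /agreeP fix_u ik; rewrite ltnNge; apply/negP => kui.
have:= fix_u _ kui; rewrite perm1 => /perm_inj uii.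
by rewrite -uii leqNgt ik in kui.
Qed.

Lemma card_first k : k <= n -> #|first n k| = k.
Proof.
move=> kn; rewrite -[RHS]card_ord.
have inj_w : injective (widen_ord kn) by move=> i j [] /val_inj.
rewrite -(card_imset _ inj_w); apply: eq_card => i; rewrite inE.
apply/idP/imsetP => [ik|[j _ ->]] /=; last exact: ltn_ord.
by exists (Ordinal ik) => //; apply: val_inj.
Qed.

Lemma card_agree k p : k <= n -> #|[pred q | agree k p q]| = k`!.
Proof.
move=> kn; rewrite -[in RHS](card_first kn) -card_Sym -[RHS](card_imset _ (mulIg p)).
apply: eq_card => q; apply/idP/imsetP => [pq|[u Gu ->]].
  exists (quo p q); last by rewrite -/(rmul _ _) rmul_quo.
  by have: agree k p q := pq; rewrite agree_quo.
by have: agree k p (rmul p u) by rewrite agree_rmul.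
Qed.

(** * Cycles on a prefix *)

(** The traject of the last prefix position meets no repetition exactly when
   the orbit fills the prefix, so being a cycle is a statement about which
   cosets of the previous prefix group the powers of [u] reach. *)
Lemma kcycle_uniq k (x : 'I_n) u : x = k :> nat ->
  is_kcycle k.+1 u = (u \in G n k.+1) && uniq (traject u x k.+1).
Proof.
move=> xk; rewrite /is_kcycle; have [Gu|//] := boolP (u \in _); rewrite !andTb.
have kn : k < n by rewrite -xk.
have x_first : x \in first n k.+1 by rewrite inE xk.
apply/idP/idP => [/imsetP[y _ Ey]|uniq_x].
  have Ex : first n k.+1 = porbit u x.
    by apply/esym; rewrite Ey; apply/eqP; rewrite eq_porbit_mem -Ey.
  by have := uniq_traject_porbit u x; rewrite -Ex card_first.
apply/imsetP; exists x => //; apply/esym/eqP; rewrite eqEcard card_first //.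
have sub : {subset traject u x k.+1 <= porbit u x}.
  by move=> _ /trajectP[i _ ->]; rewrite -permX mem_porbit.
apply/andP; split.
  apply/subsetP => y; rewrite porbit_traject => /trajectP[i _ ->].
  by rewrite inE -permX; apply: G_lt; rewrite ?expg_G // xk.
rewrite -{1}(size_traject u x k.+1) -(card_uniqP uniq_x).
exact/subset_leq_card/subsetP.
Qed.

Lemma kcycle_orbit k (x : 'I_n) u : x = k :> nat -> is_kcycle k.+1 u ->
  forall y : 'I_n, y <= k -> y \in traject u x k.+1.
Proof.
move=> xk /andP[_ /imsetP[z _ Ez]] y yk.
have kn : k < n by rewrite -xk.
have Ex : first n k.+1 = porbit u x.
  by apply/esym; rewrite Ez; apply/eqP; rewrite eq_porbit_mem -Ez inE xk.
have -> : k.+1 = #|porbit u x| by rewrite -Ex card_first.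
by rewrite -porbit_traject -Ex inE.
Qed.

Lemma kcycle_expg k u : k <= n -> is_kcycle k u -> (u ^+ k = 1)%g.
Proof.
move=> kn /andP[]; rewrite mem_G => /agreeP fix_u /imsetP[z _ Ez].
apply/permP => y; rewrite permX perm1; case: (ltnP y k) => [yk|/fix_u].
  have Ey : first n k = porbit u y.
    by apply/esym; rewrite Ez; apply/eqP; rewrite eq_porbit_mem -Ez inE.
  by rewrite -{1}(card_first kn) Ey iter_porbit.
by rewrite perm1 => uy; rewrite iter_fix.
Qed.

(** A cycle on the first [k.+1] positions moves the last of them to each of
   these positions once, and the image of that position tells the cosets of
   the smaller group apart. *)
Lemma count_agree_powers k u p q : k < n -> is_kcycle k.+1 u ->
  count (fun j => agree k (rmul p (u ^+ j)%g) q) (iota 0 k.+1)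
    = agree k.+1 p q.
Proof.
move=> kn cu; pose x := Ordinal kn.
have:= cu; rewrite (kcycle_uniq _ (erefl : x = k :> nat)) => /andP[Gu uniq_x].
have agS j : agree k.+1 (rmul p (u ^+ j)%g) q = agree k.+1 p q.
  by apply: agree_eql; rewrite agree_sym agree_rmul expg_G.
have [pq|npq] := boolP (agree k.+1 p q); last first.
  apply/eqP; rewrite -leqn0 leqNgt -has_count; apply/hasPn => j _.
  by apply: contra npq => /(agree_le (leqnSn k)); rewrite agS.
(* The class of [q] is reached by the power that sends [x] to [y]. *)
pose y := (p^-1)%g (q x).
have qx : q x = p y by rewrite /y -permM mulVg perm1.
have yk : y <= k.
  rewrite leqNgt; apply/negP => ky; move/agreeP/(_ y ky): pq.
  by rewrite -qx => /perm_inj xy; move: ky; rewrite -xy ltnn.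
have <- : count_mem y (traject u x k.+1) = true.
  by rewrite count_uniq_mem // (kcycle_orbit (erefl : x = k :> nat)).
have -> : traject u x k.+1 = [seq iter j u x | j <- iota 0 k.+1].
  apply: (@eq_from_nth _ x) => [|i];
    rewrite size_traject ?size_map ?size_iota // => ik.
  by rewrite nth_traject // (nth_map 0) ?size_iota // nth_iota.
rewrite count_map; apply: eq_count => j /=.
apply/agreeP/eqP => [/(_ x (leqnn k))|uj i].
  by rewrite rmulE qx permX => /perm_inj.
rewrite leq_eqVlt => /orP[/eqP ki|ki]; last first.
  by move: pq; rewrite -(agS j) => /agreeP ->.
have -> : i = x by apply: val_inj.
by rewrite rmulE permX uj qx.
Qed.

End Cosets.

(** * Words and walks *)

Section Words.

Variable n : nat.
Implicit Types (p q s : 'S_n) (w : seq 'S_n) (a : nat -> 'S_n) (k : nat).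

Definition eval w : 'S_n := foldl (@rmul n) 1%g w.

Lemma foldl_rmul p w : foldl (@rmul n) p w = rmul p (eval w).
Proof.
rewrite /eval; elim: w p => [|s w IH] p /=; first by rewrite /rmul mul1g.
by rewrite IH [in RHS]IH /rmul mulg1 mulgA.
Qed.

Lemma eval_cat w1 w2 : eval (w1 ++ w2) = rmul (eval w1) (eval w2).
Proof. by rewrite {1}/eval foldl_cat foldl_rmul. Qed.

Lemma eval_rcons w s : eval (rcons w s) = rmul (eval w) s.
Proof. by rewrite /eval foldl_rcons. Qed.

Lemma size_walk p w : size (walk p w) = (size w).+1.
Proof. by rewrite /walk /= size_scanl. Qed.

Lemma walk_cat_rcons p w s w2 :
  walk p (rcons w s ++ w2) = walk p w ++ walk (rmul p (rmul (eval w) s)) w2.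
Proof.
rewrite /walk -cats1 -catA cat1s scanl_cat /= foldl_rmul.
by rewrite /rmul !mulgA.
Qed.

Lemma walk_rcons p w s :
  walk p (rcons w s) = rcons (walk p w) (rmul p (eval (rcons w s))).
Proof.
by rewrite -[rcons w s]cats0 walk_cat_rcons cats0 eval_rcons /walk cats1.
Qed.

Lemma nth_walkS p w i : i < size w ->
  nth 1%g (walk p w) i.+1 = rmul (nth 1%g (walk p w) i) (nth 1%g w i).
Proof.
move=> iw; rewrite /walk !nth_cons_scanl ?(ltnW iw) //.
by rewrite (take_nth 1%g) // foldl_rcons.
Qed.

Lemma nth_walk_last p w : nth 1%g (walk p w) (size w) = rmul p (eval w).
Proof. by rewrite /walk nth_cons_scanl // take_size foldl_rmul. Qed.

Lemma path_walk (A : seq 'S_n) p w :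
  {subset w <= A} -> path (cayley A) p (scanl (@rmul n) p w).
Proof.
elim: w p => //= s w IH p sub; apply/andP; split.
  by apply/hasP; exists s => //; apply: sub; rewrite mem_head.
by apply: IH => t tw; apply: sub; rewrite in_cons tw orbT.
Qed.

Lemma size_Mword a k : (size (Mword a k)).+1 = k`!.
Proof.
elim: k => //= k IH; rewrite size_cat size_flatten /shape map_nseq sumn_nseq.
by rewrite size_rcons IH -addnS IH factS mulSn mulnC addnC.
Qed.

Lemma size_walk_Mword a k p : size (walk p (Mword a k)) = k`!.
Proof. by rewrite size_walk size_Mword. Qed.

Lemma eq_Mword a b k : (forall j, 2 <= j <= k -> a j = b j) ->
  Mword a k = Mword b k.
Proof.
elim: k => //= -[|k] IH ab //; rewrite IH => [|j /andP[j2 jk]].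
  by rewrite (ab k.+2) ?leqnn.
by apply: ab; rewrite j2 leqW.
Qed.

Lemma mem_Mword a k (A : seq 'S_n) : (forall j, 2 <= j <= k -> a j \in A) ->
  {subset Mword a k <= A}.
Proof.
elim: k => //= -[|k] IH aA s //; rewrite mem_cat.
have {}IH : {subset Mword a k.+1 <= A}.
  by apply: IH => j /andP[j2 jk]; apply: aA; rewrite j2 leqW.
case/orP => [/flattenP[w]|]; last exact: IH.
move=> /nseqP[-> _]; rewrite mem_rcons in_cons => /orP[/eqP->|]; last exact: IH.
by apply: aA; rewrite leqnn.
Qed.

(** The repeated factor of [Mword a k.+1] acts as a single element [step a k],
   by whose powers the blocks of the walk are translated. *)
Definition step a k : 'S_n := rmul (eval (Mword a k)) (a k.+1).

Lemma eval_nseq j w : eval (flatten (nseq j w)) = (eval w ^+ j)%g.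
Proof. by elim: j => //= j IH; rewrite eval_cat IH /rmul expgSr. Qed.

Lemma eval_Mword a k :
  eval (Mword a k.+1) = rmul (step a k ^+ k)%g (eval (Mword a k)).
Proof. by rewrite /= eval_cat eval_nseq eval_rcons. Qed.

Lemma walk_repeat m p w s : walk p (flatten (nseq m (rcons w s)) ++ w) =
  flatten [seq walk (rmul p (eval (rcons w s) ^+ j)%g) w | j <- iota 0 m.+1].
Proof.
elim: m p => [|m IH] p; first by rewrite /= cats0 expg0 /rmul mul1g.
rewrite [nseq _ _]/= [flatten (_ :: _)]/= -catA walk_cat_rcons -eval_rcons IH.
rewrite -[iota 0 m.+2]/(0 :: iota (1 + 0) m.+1) iotaDl map_cons -map_comp.
have flattenE (x : seq 'S_n) y : flatten (x :: y) = x ++ flatten y by [].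
rewrite flattenE expg0 [rmul p 1]mul1g.
congr (_ ++ flatten _).
by apply: eq_map => j /=; rewrite /rmul expgSr mulgA.
Qed.

Lemma walk_Mword a k p : walk p (Mword a k.+1) =
  flatten [seq walk (rmul p (step a k ^+ j)%g) (Mword a k) | j <- iota 0 k.+1].
Proof. by rewrite [Mword a k.+1]/= walk_repeat eval_rcons. Qed.

Lemma step_quo a k : eval (Mword a k) = (a k)^-1%g ->
  step a k = quo (a k) (a k.+1).
Proof. by rewrite /step => ->. Qed.

(** If [u] is the quotient, then [Mword a k.+1] followed by [a k.+1] has the
   value [u^(k+1) = 1]. *)
Lemma eval_Mword_inv a k : k < n -> eval (Mword a k) = (a k)^-1%g ->
  is_kcycle k.+1 (quo (a k) (a k.+1)) ->
  eval (Mword a k.+1) = (a k.+1)^-1%g.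
Proof.
move=> kn ev /(kcycle_expg kn); rewrite eval_Mword (step_quo ev) ev.
rewrite expgS => uk.
have -> : (quo (a k) (a k.+1) ^+ k)%g = (quo (a k) (a k.+1))^-1%g.
  by apply: (mulgI (quo (a k) (a k.+1))); rewrite mulgV.
by rewrite /rmul /quo /rmul invMg invgK mulKg.
Qed.

End Words.

(** * The walk of a tower *)

Section Towers.

Variable n : nat.
Implicit Types (p q : 'S_n) (a : nat -> 'S_n) (k m : nat).

Lemma is_kcycle1 : 0 < n -> is_kcycle 1 (1 : 'S_n)%g.
Proof.
move=> n0; rewrite (kcycle_uniq _ (erefl : Ordinal n0 = 0 :> nat)).
by rewrite mem_G agree_refl.
Qed.

Lemma tower_kcycle (g : n.-1.-tuple 'S_n) : is_tower g ->
  forall k, k < n -> is_kcycle k.+1 (quo (letter g k) (letter g k.+1)).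
Proof.
move=> tg [|k] kn; last by have [] := tg k.+2 kn.
by rewrite /quo /rmul /letter invg1 mulg1; apply: is_kcycle1.
Qed.

Lemma eval_Mword_tower a m : m <= n -> a 0 = 1%g ->
  (forall k, k < m -> is_kcycle k.+1 (quo (a k) (a k.+1))) ->
  eval (Mword a m) = (a m)^-1%g.
Proof.
elim: m => [_ -> _|m IH mn a0 ca]; first by rewrite invg1.
apply: eval_Mword_inv => //; last exact: ca.
by apply: IH (ltnW mn) a0 _ => k km; apply/ca/leqW.
Qed.

(** Stated as a count, the induction needs no separate treatment of absence of
   repetitions and of coverage: the blocks contribute one element for each
   starting point in the right coset. *)
Lemma count_walk_Mword a k p q : k <= n ->
  (forall j, j < k -> is_kcycle j.+1 (step a j)) ->
  count_mem q (walk p (Mword a k)) = agree k p q.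
Proof.
elim: k p => [|k IH] p kn ca; first by rewrite /= addn0 agree0.
rewrite -(count_agree_powers _ _ kn (ca k (leqnn _))) walk_Mword count_flatten.
rewrite -map_comp sumnE big_map -sum1_count [RHS]big_mkcond.
apply: eq_bigr => j _; rewrite /comp IH ?(ltnW kn) //; last by move=> i ik; apply/ca/leqW.
Qed.

Lemma mem_walk_Mword a k p q : k <= n ->
  (forall j, j < k -> is_kcycle j.+1 (step a j)) ->
  (q \in walk p (Mword a k)) = agree k p q.
Proof. by move=> kn ca; rewrite -has_pred1 has_count count_walk_Mword ?lt0b. Qed.

Lemma uniq_walk_Mword a k p : k <= n ->
  (forall j, j < k -> is_kcycle j.+1 (step a j)) ->
  uniq (walk p (Mword a k)).
Proof.
move=> kn ca; apply/count_mem_uniq => q.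
by rewrite count_walk_Mword ?mem_walk_Mword.
Qed.

Lemma infix_flatten (T : eqType) (s : seq T) ss : s \in ss -> infix s (flatten ss).
Proof.
by case/splitPr=> s1 s2; rewrite flatten_cat; apply/infixP;
  exists (flatten s1), (flatten s2).
Qed.

Lemma walk_Mword_block a k m p q : k <= m -> q \in walk p (Mword a m) ->
  exists2 p', infix (walk p' (Mword a k)) (walk p (Mword a m))
            & q \in walk p' (Mword a k).
Proof.
elim: m p => [|m IH] p.
  by rewrite leqn0 => /eqP-> ?; exists p; rewrite ?infix_refl.
rewrite leq_eqVlt => /orP[/eqP-> ?|km]; first by exists p; rewrite ?infix_refl.
rewrite walk_Mword => /flattenP[_ /mapP[j jk ->]] /(IH _ km)[p' sub qp'].
exists p' => //; apply: infix_trans sub _; apply: infix_flatten.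
by apply/mapP; exists j.
Qed.

Lemma consecutive_infix (T : eqType) (P : pred T) (B L : seq T) :
  uniq L -> infix B L -> B =i P -> consecutive P L.
Proof.
move=> uL sub BP; rewrite /consecutive.
rewrite (eq_filter (a2 := [in B])) => [|x]; last by rewrite /= BP.
by rewrite -(subseq_uniqP uL (infixW sub)).
Qed.

(** The class of [q] is the block that contains [q], since this block is itself
   the walk of a shorter word and covers a whole coset. *)
Lemma consecutive_walk a k p q : k <= n ->
  (forall j, j < n -> is_kcycle j.+1 (step a j)) ->
  consecutive (agree k q) (walk p (Mword a n)).
Proof.
move=> kn ca.
have [|p' sub qp'] := walk_Mword_block (a := a) (p := p) (q := q) kn.
  by rewrite mem_walk_Mword ?agree_full.
have cak j : j < k -> is_kcycle j.+1 (step a j).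
  by move=> jk; apply/ca/(leq_trans jk).
apply: consecutive_infix sub _ => [|r]; first exact: uniq_walk_Mword.
rewrite mem_walk_Mword //; move: qp'; rewrite mem_walk_Mword // => p'q.
exact: agree_eql.
Qed.

Lemma tower_step (g : n.-1.-tuple 'S_n) : is_tower g ->
  forall k, k < n -> is_kcycle k.+1 (step (letter g) k).
Proof.
move=> /tower_kcycle cg k kn; rewrite step_quo ?cg //.
by apply: eval_Mword_tower (ltnW kn) _ _ => // j jk; apply/cg/(ltn_trans jk).
Qed.

Lemma tower_cycle (g : n.-1.-tuple 'S_n) p : 1 < n -> is_tower g ->
  exists L : seq 'S_n,
    [/\ walk p (rcons (Mword (letter g) n) (letter g n)) = rcons L p,
        is_listing L,
        path.cycle (cayley g) L
      & genlex_cyclic L].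
Proof.
move=> n1 tg; set a := letter g.
have closed_walk : walk p (rcons (Mword a n) (a n)) = rcons (walk p (Mword a n)) p.
  rewrite walk_rcons eval_rcons eval_Mword_tower //; last exact: tower_kcycle.
  by rewrite /rmul mulgV mul1g.
have mem_g k : 2 <= k <= n -> a k \in g.
  case: k => [|[|k]] // /andP[_ kn]; rewrite /a /letter mem_nth // size_tuple.
  by rewrite -ltnS (ltn_predK n1).
exists (walk p (Mword a n)); split=> [//|q||k /andP[_ kn] q].
- by rewrite count_walk_Mword ?agree_full //; apply: tower_step.
- have -> : path.cycle (cayley g) (walk p (Mword a n)) =
      path (cayley g) p (behead (walk p (rcons (Mword a n) (a n)))).
    by rewrite closed_walk.
  apply: path_walk => s; rewrite mem_rcons in_cons => /orP[/eqP->|].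
    by apply: mem_g; rewrite n1 leqnn.
  exact: mem_Mword mem_g _.
by exists 0; rewrite rot0; apply: consecutive_walk kn (tower_step tg).
Qed.

End Towers.

(** * Ruler order of the letters of a word *)

Section Ruler.

Variable n : nat.
Implicit Types (a : nat -> 'S_n) (i j k m : nat).

Lemma dvdn_fact_le j k : j <= k -> j`! %| k`!.
Proof. by move=> jk; rewrite -(bin_fact jk) mulnCA dvdn_mulr. Qed.

Lemma nth_repeat (T : Type) (x0 : T) w s d m i : (size w).+1 = d ->
  i.+1 < m.+1 * d ->
  nth x0 (flatten (nseq m (rcons w s)) ++ w) i =
    if d %| i.+1 then s else nth x0 w (i %% d).
Proof.
move=> wd; have d0 : 0 < d by rewrite -wd.
elim: m i => [|m IH] i im /=.
  rewrite mul1n in im; rewrite gtnNdvd // modn_small //; exact: ltnW.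
rewrite -catA nth_cat size_rcons wd; case: ltnP => [id|di].
  rewrite nth_rcons -ltnS wd; case: (ltngtP i.+1 d) => [lt_id|lt_di|eq_id].
  - by rewrite gtnNdvd // modn_small.
  - by move: id; rewrite ltnNge -ltnS lt_di.
  by rewrite eq_id dvdnn -eqSS wd eq_id eqxx.
rewrite IH; last by rewrite -subSn // ltn_subLR ?(leqW di) // -mulSn.
have <- : (i - d) %% d = i %% d by rewrite -{2}(subnK di) modnDr.
by rewrite -subSn // dvdn_subl // leqW.
Qed.

(** The letters of [Mword a m] follow the ruler sequence in the factorial
   number system. *)
Lemma nth_Mword a m i k : i.+1 < m`! -> (k.-1)`! %| i.+1 -> ~~ (k`! %| i.+1) ->
  nth 1%g (Mword a m) i = a k.
Proof.
elim: m i k => [|m IH] i k im dk ndk; first by [].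
rewrite /= (nth_repeat _ _ (size_Mword a m)); last by rewrite -factS.
case: k dk ndk => [|k] dk ndk; first by rewrite dvd1n in ndk.
(* If [m!] divides [i.+1] then the letter is the separator [a m.+1]. *)
have [dm|ndm] := boolP (m`! %| i.+1).
  have [mk|km|-> //] := ltngtP m k; last first.
    by case/negP: ndk; apply: dvdn_trans dm; apply: dvdn_fact_le.
  case/negP: (gtnNdvd (ltn0Sn i) im); apply: dvdn_trans dk.
  exact: dvdn_fact_le.
have km : k < m.
  by rewrite ltnNge; apply: contra ndm => mk; apply: dvdn_trans dk; apply: dvdn_fact_le.
have im' : (i %% m`!).+1 < m`!.
  rewrite ltn_neqAle ltn_mod fact_gt0 andbT; apply: contra ndm => /eqP im'.
  by rewrite (divn_eq i m`!) -addnS im' -mulSnr dvdn_mull.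
have dvd_mod j : j <= m -> (j`! %| (i %% m`!).+1) = (j`! %| i.+1).
  move=> jm; rewrite {2}(divn_eq i m`!) -addnS dvdn_addr //.
  exact/dvdn_mull/dvdn_fact_le.
by apply: IH; rewrite // dvd_mod // ltnW.
Qed.

Lemma ruler_exists m i : i.+1 < m`! ->
  exists k, [/\ 1 < k <= m, (k.-1)`! %| i.+1 & ~~ (k`! %| i.+1)].
Proof.
move=> im.
have ex_k : exists k, ~~ (k`! %| i.+1) by exists m; rewrite gtnNdvd.
case: (ex_minnP ex_k) => k ndk min_k; exists k; split=> //.
  rewrite min_k ?gtnNdvd // andbT ltnNge.
  by apply: contra ndk; case: k {min_k} => [|[]] // _; rewrite dvd1n.
case: k ndk min_k => [|k] ndk min_k; first by rewrite dvd1n in ndk.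
by apply/negPn/negP => /min_k; rewrite ltnn.
Qed.

End Ruler.

(** * Positions of the classes in a genlex listing *)

Lemma consecutive_interval (T : eqType) (x0 : T) (P : pred T) L :
  consecutive P L ->
  exists s, forall j, j < size L -> P (nth x0 L j) = (s <= j < s + count P L).
Proof.
case/infixP=> s1 [s2 E]; exists (size s1) => j jL.
have: count P L = count P s1 + (count P L + count P s2).
  rewrite {1}E !count_cat count_filter; congr (_ + (_ + _)).
  by apply: eq_count => x /=; rewrite andbb.
move/eqP; rewrite addnCA -{1}[count P L]addn0 eqn_add2l eq_sym addn_eq0.
rewrite -!leqn0 ![_ <= 0]leqNgt -!has_count => /andP[n1 n2].
rewrite -size_filter; rewrite {1}E !nth_cat; case: ltnP => [js1|s1j].
  by apply/negbTE; apply: (hasPn n1); apply: mem_nth.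
rewrite ltn_subLR //; case: ltnP => [jd|dj].
  have : nth x0 (filter P L) (j - size s1) \in filter P L.
    by rewrite mem_nth // ltn_subLR.
  by rewrite mem_filter => /andP[-> _].
apply/negbTE; apply: (hasPn n2); apply: mem_nth.
rewrite -subnDA ltn_subLR //.
by rewrite -addnA -!size_cat -E.
Qed.

(** The classes occupy intervals of the same length [d], which tile the sequence
   from its beginning, so each starts at a multiple of [d]. *)
Lemma consecutive_classes (T : eqType) (x0 : T) (e : rel T) d L :
  equivalence_rel e -> 0 < d ->
  (forall x, x \in L -> count (e x) L = d) ->
  (forall x, x \in L -> consecutive (e x) L) ->
  forall i j, i < size L -> j < size L ->
    e (nth x0 L i) (nth x0 L j) = (i %/ d == j %/ d).
Proof.
move=> eqv d0 cardL consL.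
have refl x : e x x by have [] := eqv x x x.
have eql x y : e x y -> e x =1 e y by move=> xy z; have [_ ->] := eqv x y z.
have key i : i < size L -> exists c, forall j, j < size L ->
    e (nth x0 L i) (nth x0 L j) = (c * d <= j < c * d + d).
  elim/ltn_ind: i => i IH iL.
  have [s] := consecutive_interval x0 (consL _ (mem_nth x0 iL)).
  rewrite cardL ?mem_nth // => sP.
  have := sP i iL; rewrite refl => /esym/andP[si isd].
  case: s si sP isd => [|s] si sP isd; first by exists 0.
  have sL : s.+1 < size L by apply: leq_ltn_trans iL.
  have [c cP] := IH s si (ltnW sL).
  have := cP s (ltnW sL); rewrite refl => /esym/andP[cs scd].
  (* The interval of [s] ends just before [s.+1]; otherwise [s] and [s.+1], hence
     [s] and [i], would be in the same class. *)
  suff Es : s.+1 = c.+1 * d by exists c.+1; rewrite -Es.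
  apply/eqP; rewrite eqn_leq mulSnr scd leqNgt; apply/negP => lt_s.
  have ss : e (nth x0 L s.+1) (nth x0 L s).
    have: e (nth x0 L s) (nth x0 L s.+1) by rewrite cP // lt_s (leqW cs).
    by move/eql => <-.
  have is1 : e (nth x0 L i) (nth x0 L s.+1).
    by rewrite sP // leqnn -[X in X < _]addn0 ltn_add2l.
  by have := sP s (ltnW sL); rewrite (eql _ _ is1) ss ltnn.
move=> i j iL jL; have [c cP] := key i iL.
have divP m : (c * d <= m < c * d + d) = (m %/ d == c).
  by rewrite addnC -mulSn -ltn_divLR // ltnS -leq_divRL // eqn_leq andbC.
have := cP i iL; rewrite refl divP => /esym/eqP->.
by rewrite cP // divP eq_sym.
Qed.

(** * Genlex listings with one generator for each layer *)

Section Listings.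

Variables (n : nat) (L : seq 'S_n).
Hypothesis L_listing : is_listing L.
Hypothesis L_genlex : genlex L.
Implicit Types (a : nat -> 'S_n) (i j k m : nat).

Local Notation "L_[ i ]" := (nth 1%g L i) (format "L_[ i ]").

Lemma count_listing (P : pred 'S_n) : count P L = #|P|.
Proof.
have perm_L : perm_eq L (index_enum 'S_n).
  apply: uniq_perm; rewrite ?index_enum_uniq //.
    by apply: count_mem_uniq => q; rewrite L_listing -has_pred1 has_count L_listing.
  by move=> q; rewrite mem_index_enum -has_pred1 has_count L_listing.
by rewrite -sum1_count (perm_big _ perm_L) sum1_card.
Qed.

Lemma size_listing : size L = n`!.
Proof.
rewrite -(card_agree 1%g (leqnn n)) -count_listing -count_predT.
by apply: eq_count => q; rewrite /= agree_full.
Qed.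

Lemma agree_listing k i j : 0 < k <= n -> i < n`! -> j < n`! ->
  agree k L_[i] L_[j] = (i %/ k`! == j %/ k`!).
Proof.
move=> kn; rewrite -size_listing; have /andP[_ k_le_n] := kn.
apply: (consecutive_classes 1%g _ (fact_gt0 k)) => [p q r|p _|p _].
- by split=> [|pq]; [apply: agree_refl | apply: agree_eql].
- by rewrite count_listing -[RHS](card_agree p k_le_n).
exact: L_genlex.
Qed.

(** Positions [i] and [i.+1] are in the same interval of length [d] unless [d]
   divides [i.+1]. *)
Lemma quo_layer k i : 1 < k <= n -> i.+1 < n`! ->
  (k.-1)`! %| i.+1 -> ~~ (k`! %| i.+1) -> quo L_[i] L_[i.+1] \in layer n k.
Proof.
case: k => [|[|k]] // kn i_n dk ndk; rewrite mem_layer.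
rewrite !agree_listing ?(ltnW i_n) ?ltnS ?(ltnW kn) // !divnS ?fact_gt0 //.
by rewrite dk (negbTE ndk) add0n eqxx add1n neq_ltn ltnSn.
Qed.

Lemma mem_generators i : i.+1 < size L -> quo L_[i] L_[i.+1] \in generators L.
Proof.
move=> iL; have lt_i : i < (size L).-1 by rewrite -ltnS (ltn_predK iL).
by apply/imsetP; exists (Ordinal lt_i).
Qed.

(** The initial coset of [G n k.-1] ends at position [(k - 1)! - 1], so this is
   the earliest transition that can lie in the layer [k]. *)
Definition layer_gen k : 'S_n := quo L_[(k.-1)`!.-1] L_[(k.-1)`!].

Lemma fact_pred_lt k : 1 < k <= n -> (k.-1)`! < k`! <= n`!.
Proof.
case: k => [|[|k]] // kn.
by rewrite ltn_fact // dvdn_leq ?fact_gt0 // dvdn_fact_le.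
Qed.

Lemma layer_gen_mem k : 1 < k <= n -> layer_gen k \in generators L :&: layer n k.
Proof.
move=> kn; have /andP[lt_k le_k] := fact_pred_lt kn.
have lt_n := leq_trans lt_k le_k.
rewrite /layer_gen -{2}(prednK (fact_gt0 k.-1)) inE mem_generators ?quo_layer //;
  rewrite ?prednK ?fact_gt0 ?size_listing //.
by rewrite gtnNdvd ?fact_gt0.
Qed.

Hypothesis card_gens : #|generators L| = n.-1.

(** The layers are disjoint and each contains a generator, so [n - 1]
   generators leave no room for two in the same layer. *)
Lemma generators_layer k : 1 < k <= n ->
  generators L :&: layer n k = [set layer_gen k].
Proof.
move=> kn; pose t (i : 'I_n.-1) := layer_gen i.+2.
have t_mem (i : 'I_n.-1) : t i \in generators L :&: layer n i.+2.
  by apply: layer_gen_mem; rewrite /= -ltn_predRL.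
have t_inj : injective t.
  move=> i j tij; have := t_mem i; rewrite tij inE => /andP[_ ti].
  by have := t_mem j; rewrite inE => /andP[_ /(layer_inj ti)[] /val_inj].
have genE : [set t i | i : 'I_n.-1] = generators L.
  apply/eqP; rewrite eqEcard (card_imset _ t_inj) card_gens card_ord leqnn andbT.
  by apply/subsetP => _ /imsetP[i _ ->]; have := t_mem i; rewrite inE => /andP[].
apply/setP => s; rewrite [RHS]inE; apply/idP/eqP => [|->]; last exact: layer_gen_mem.
rewrite inE -genE => /andP[/imsetP[i _ ->]].
by have := t_mem i; rewrite inE => /andP[_ /layer_inj E] /E <-.
Qed.

Section Tower.

Variable a : nat -> 'S_n.
Hypothesis aE : forall k, 1 < k <= n -> a k = layer_gen k.

Lemma listing_step k i : 1 < k <= n -> i.+1 < n`! ->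
  (k.-1)`! %| i.+1 -> ~~ (k`! %| i.+1) -> L_[i.+1] = rmul L_[i] (a k).
Proof.
move=> kn i_n dk ndk.
have: quo L_[i] L_[i.+1] \in generators L :&: layer n k.
  by rewrite inE quo_layer // mem_generators // size_listing.
by rewrite generators_layer // inE -aE // => /eqP <-; rewrite rmul_quo.
Qed.

(** Translating by a multiple [s] of [k!] does not change which factorials up to
   [k!] divide a position, so each aligned block of length [k!] reads the same
   word. *)
Lemma listing_block k s i : k <= n -> k`! %| s -> s + k`! <= n`! -> i < k`! ->
  L_[s + i] = nth 1%g (walk L_[s] (Mword a k)) i.
Proof.
move=> kn ds sn; elim: i => [|i IH] ik; first by rewrite addn0.
rewrite nth_walkS -?IH ?(ltnW ik) //; last by rewrite -ltnS size_Mword.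
have [r [/andP[r1 rk] dr ndr]] := ruler_exists ik.
rewrite (nth_Mword _ ik dr ndr) addnS.
have dvd_s j : j <= k -> (j`! %| (s + i).+1) = (j`! %| i.+1).
  by move=> jk; rewrite -addnS dvdn_addr // (dvdn_trans _ ds) ?dvdn_fact_le.
apply: listing_step; rewrite ?dvd_s ?r1 ?(leq_trans rk) ?(leq_trans (leq_pred r)) //.
by rewrite -addnS (leq_trans _ sn) // ltn_add2l.
Qed.

Lemma listing_walk : L = walk L_[0] (Mword a n).
Proof.
apply: (@eq_from_nth _ 1%g); first by rewrite size_listing size_walk_Mword.
move=> i; rewrite size_listing => i_n.
by rewrite -(listing_block (s := 0)) ?dvdn0.
Qed.

Hypothesis a0 : a 0 = 1%g.
Hypothesis a1 : a 1 = 1%g.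

(** Consecutive blocks of the first coset of [G n k.+1] start at points that
   differ by the quotient, and genlex order keeps these starting points in
   distinct cosets of [G n k], so the quotient is a cycle; knowing that, the
   value of the next word is known, which gives the next quotient. *)
Lemma listing_kcycle m k : k < m <= n -> is_kcycle k.+1 (quo (a k) (a k.+1)).
Proof.
elim: m k => // m IH k /andP[]; rewrite ltnS leq_eqVlt.
case/orP=> [/eqP-> mn|km mn]; last by apply: IH; rewrite km ltnW.
have [->|m0] := posnP m.
  by rewrite a0 a1 /quo /rmul invg1 mulg1 is_kcycle1 // (leq_ltn_trans _ mn).
have ev : eval (Mword a m) = (a m)^-1%g.
  apply: eval_Mword_tower => // [|j jm]; first exact: ltnW.
  by apply: IH; rewrite jm ltnW.
set u := quo _ _; pose x := Ordinal mn; have d0 := fact_gt0 m.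
have lt_fact j : j <= m -> j * m`! < n`!.
  move=> jm; apply: (@leq_trans (m.+1)`!); last first.
    by rewrite dvdn_leq ?fact_gt0 // dvdn_fact_le.
  by rewrite factS ltn_pmul2r.
(* The value [(a m)^-1] of a block and the letter [a m.+1] after it compose
   to [u]. *)
have starts j : j <= m -> L_[j * m`!] = rmul L_[0] (u ^+ j)%g.
  elim: j => [|j IHj] jm; first by rewrite expg0 /rmul mul1g.
  have lt_j := lt_fact _ jm.
  have E : (j * m`! + (m`!).-1).+1 = j.+1 * m`! by rewrite -addnS prednK // mulSnr.
  rewrite -{1}E (@listing_step m.+1) ?E ?ltnS ?m0 //=; last first.
  - by rewrite factS dvdn_pmul2r // gtnNdvd.
  - exact: dvdn_mull.
  rewrite (@listing_block m) ?dvdn_mull ?prednK ?(ltnW mn) //; last first.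
    by rewrite -mulSnr ltnW.
  have -> : (m`!).-1 = size (Mword a m) by rewrite -(size_Mword a m).
  by rewrite nth_walk_last ev IHj ?(ltnW jm) // /u /quo /rmul expgS !mulgA.
have Gu : u \in G n m.+1.
  have /= := starts 1%N m0; rewrite expg1 => E.
  rewrite -(agree_rmul _ L_[0]) -E agree_listing ?fact_gt0 ?lt_fact //.
  by rewrite div0n mul1n divn_small // ltn_fact.
rewrite (kcycle_uniq _ (erefl : x = m :> nat)) Gu.
apply/(uniqP x) => i j; rewrite !inE size_traject !ltnS => im jm.
rewrite !nth_traject ?ltnS // => Eij.
have: agree m L_[i * m`!] L_[j * m`!].
  rewrite !starts //; apply/agreeP => y; rewrite !rmulE leq_eqVlt !permX.
  case/orP => [/eqP my|my].
    have -> : y = x by apply: val_inj.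
    by rewrite Eij.
  have fix_u : u y = y.
    by move: Gu; rewrite mem_G => /agreeP/(_ y my); rewrite perm1.
  by rewrite !iter_fix.
by rewrite agree_listing ?lt_fact ?m0 ?(ltnW mn) // !mulnK // => /eqP.
Qed.

End Tower.

(** At the end of the initial coset of [G n k.-1] the word reads [h k], so the
   listing determines its letters. *)
Lemma listing_letter (h : nat -> 'S_n) k : 1 < k <= n ->
  L = walk L_[0] (Mword h n) -> h k = layer_gen k.
Proof.
move=> kn EL; have /andP[lt_k le_k] := fact_pred_lt kn.
have lt_n := leq_trans lt_k le_k.
have E := prednK (fact_gt0 k.-1).
rewrite /layer_gen -{2}E EL nth_walkS; last by rewrite -ltnS size_Mword E.
by rewrite quo_rmul; apply/esym/nth_Mword; rewrite E // gtnNdvd ?fact_gt0.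
Qed.

End Listings.

(** * From listings to towers *)

Section Assembly.

Variable n : nat.
Implicit Types (k : nat).

Lemma letter_mktuple (f : nat -> 'S_n) k : 1 < k <= n ->
  letter [tuple f i.+2 | i < n.-1] k = f k.
Proof.
case: k => [|[|k]] // kn; have lt_k : k < n.-1 by rewrite -ltnS (ltn_predK kn).
exact: (nth_mktuple (fun i : 'I_n.-1 => f i.+2) 1%g (Ordinal lt_k)).
Qed.

Lemma eq_letter (g h : n.-1.-tuple 'S_n) :
  (forall k, 1 < k <= n -> letter g k = letter h k) -> g = h.
Proof.
move=> gh; apply: eq_from_tnth => i; rewrite !(tnth_nth 1%g).
by apply: (gh i.+2); rewrite /= -ltn_predRL.
Qed.

Lemma genlex_tower L : is_listing L -> genlex L -> #|generators L| = n.-1 ->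
  exists g : n.-1.-tuple 'S_n,
    [/\ unique (fun h : n.-1.-tuple 'S_n =>
          is_tower h /\ L = walk (nth 1%g L 0) (Mword (letter h) n)) g,
        forall k, 2 <= k <= n -> generators L :&: layer n k = [set letter g k]
      & forall k, 2 <= k <= n -> is_kcycle k (quo (letter g k.-1) (letter g k))].
Proof.
move=> L_listing L_genlex card_gens.
pose g := [tuple layer_gen L i.+2 | i < n.-1].
have gE k : 1 < k <= n -> letter g k = layer_gen L k by apply: letter_mktuple.
have gens k : 2 <= k <= n -> generators L :&: layer n k = [set letter g k].
  by move=> kn; rewrite gE // generators_layer.
have cyc k : 2 <= k <= n -> is_kcycle k (quo (letter g k.-1) (letter g k)).
  case: k => // k /andP[_ kn].
  apply: (@listing_kcycle n L L_listing L_genlex card_gens (letter g) gE _ _ n) => //.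
  by rewrite kn leqnn.
exists g; split=> //; split=> [|h [_ Lh]].
  split=> [k kn|]; last exact: listing_walk.
  split; last exact: cyc.
  by have := set11 (letter g k); rewrite -gens // inE => /andP[].
by apply: eq_letter => k kn; rewrite gE // (listing_letter kn Lh).
Qed.

(** * Prefix reversals *)

Lemma reversal_lt k (i : 'I_n) : k <= n -> i < k ->
  reversal n k i = k - i.+1 :> nat.
Proof.
move=> kn ik; rewrite permE /rev_fun ik val_insubd.
by rewrite (leq_trans _ kn) // ltn_subrL (leq_ltn_trans _ ik).
Qed.

Lemma reversal_ge k (i : 'I_n) : k <= i -> reversal n k i = i.
Proof. by move=> ki; rewrite permE /rev_fun ltnNge ki. Qed.

Lemma reversalV k : (reversal n k)^-1%g = reversal n k.
Proof.
apply/eqP; rewrite eq_invg_mul; apply/eqP/permP => i.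
by rewrite permM !permE /= rev_funK.
Qed.

Lemma reversal1 : reversal n 1 = 1%g.
Proof.
apply/permP => i; rewrite perm1; have [i0|] := ltnP i 1; last exact: reversal_ge.
apply: ord_inj; rewrite reversal_lt ?(leq_ltn_trans _ (ltn_ord i)) //.
by case: (nat_of_ord i) i0.
Qed.

Lemma reversal_layer k : 1 < k <= n -> reversal n k \in layer n k.
Proof.
case/andP=> k1 kn.
rewrite in_setD !mem_G; apply/andP; split; last first.
  by apply/agreeP => i /reversal_ge ->; rewrite perm1.
pose x := Ordinal (leq_trans (eq_leq (ltn_predK k1)) kn).
apply/negP => /agreeP/(_ x (leqnn _)); rewrite perm1 => /(congr1 (@nat_of_ord n)).
rewrite reversal_lt //= ?(ltn_predK k1) // subnn => k10.
by have:= k1; rewrite -(ltn_predK k1) k10.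
Qed.

(** The quotient of consecutive reversals is the rotation of the prefix
   that moves each position one step down, cyclically. *)
Lemma reversal_kcycle k : k < n ->
  is_kcycle k.+1 (quo (reversal n k) (reversal n k.+1)).
Proof.
move=> kn; set u := quo _ _; pose x := Ordinal kn.
have u_pred (i : 'I_n) : 0 < i <= k -> u i = i.-1 :> nat.
  case/andP=> i0 ik; rewrite quoE reversalV.
  have E : reversal n k.+1 i = k - i :> nat by rewrite reversal_lt // subSS.
  have lt_k : k - i < k by rewrite ltn_subrL i0 (leq_trans i0).
  by rewrite reversal_lt ?E // ?(ltnW kn) // subnS subKn.
have iter_u j : j <= k -> iter j u x = k - j :> nat.
  elim: j => [|j IH] jk /=; first by rewrite subn0.
  by rewrite u_pred IH ?(ltnW jk) ?subn_gt0 ?jk ?leq_subr // subnS.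
rewrite (kcycle_uniq _ (erefl : x = k :> nat)); apply/andP; split.
  rewrite mem_G; apply/agreeP => i ki; rewrite perm1 quoE reversalV.
  by rewrite (reversal_ge ki) reversal_ge // ltnW.
apply/(uniqP x) => i j; rewrite !inE size_traject !ltnS => ik jk.
rewrite !nth_traject ?ltnS // => /(congr1 (@nat_of_ord n)); rewrite /= !iter_u // => E.
by rewrite -(subKn ik) E subKn.
Qed.

Lemma zaks_letter k : 1 < k <= n -> letter (zaks_gens n) k = reversal n k.
Proof. exact: letter_mktuple. Qed.

Lemma zaks_tower : is_tower (zaks_gens n).
Proof.
move=> k kn; rewrite zaks_letter //; split; first exact: reversal_layer.
suff -> : letter (zaks_gens n) k.-1 = reversal n k.-1.
  by case: k kn => // k /andP[_]; apply: reversal_kcycle.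
case: k kn => [|[|[|k]]] // kn; first by rewrite reversal1.
by rewrite zaks_letter //= ltnW.
Qed.

End Assembly.

Theorem theorem3p3 (n : nat) (hn : 3 <= n) :
  [/\ (* (i) *)
      forall g : n.-1.-tuple 'S_n, is_tower g -> forall p : 'S_n,
        exists L : seq 'S_n,
          [/\ walk p (rcons (Mword (letter g) n) (letter g n)) = rcons L p,
              is_listing L,
              path.cycle (cayley g) L
            & genlex_cyclic L],
      (* (ii) *)
      forall L : seq 'S_n, is_listing L -> genlex L ->
        #|generators L| = n.-1 ->
        exists g : n.-1.-tuple 'S_n,
          [/\ unique (fun h : n.-1.-tuple 'S_n =>
                is_tower h /\ L = walk (nth 1%g L 0) (Mword (letter h) n)) g,
              forall k, 2 <= k <= n ->
                generators L :&: layer n k = [set letter g k]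
            & forall k, 2 <= k <= n ->
                is_kcycle k (quo (letter g k.-1) (letter g k))]
    & (* Zaks' order *)
      [/\ forall k, 2 <= k <= n -> letter (zaks_gens n) k = reversal n k,
          is_tower (zaks_gens n)
        & forall p : 'S_n,
            zaks_order p = walk p (Mword (letter (zaks_gens n)) n)]].
Proof.
split.
- by move=> g tg p; apply: tower_cycle tg; apply: ltnW.
- exact: genlex_tower.
split; [exact: zaks_letter | exact: zaks_tower |].
by move=> p; congr walk; apply: eq_Mword => k /zaks_letter ->.
Qed.
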